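(* Let $K$ be a quadratic field with embeddings into $\mathbb{R}$ and $\mathbb{Q}_2$, and let $\alpha\in K\setminus\mathbb{Q}$ have property $I$. With $p'_n,q'_n$ as defined in the context, there exist $\gamma,C,C'\in\mathbb{R}_{>0}$ with $0<\gamma<1$ such that for all $n\in\mathbb{Z}_{>0}$, $$\left|\alpha_\infty-\frac{p'_n}{q'_n}\right|\le\frac{C}{|q'_n|^{2-2\gamma}}\quad\text{and}\quad\left|\alpha_{\langle 2\rangle}-\frac{p'_n}{q'_n}\right|_2\le\frac{C'}{|q'_n|^{2\gamma}}.$$
   Context: $K$ is a quadratic field with fixed field embeddings $\sigma_\infty:K\to\mathbb{R}$ and $\sigma_2:K\to\mathbb{Q}_2$. For $\alpha\in K$ write $\alpha_\infty=\sigma_\infty(\alpha)$, $\alpha_{\langle 2\rangle}=\sigma_2(\alpha)$. $v_2$ is the $2$-adic valuation and $|u|_2=2^{-v_2(u)}$; $|\cdot|$ is the real absolute value. For $u=\sum_{n}c_n2^n\in\mathbb{Q}_2$ with digits $c_n\in\{0,1\}$ ($c_n=0$ for $n<v_2(u)$), put $\lfloor u\rfloor_2=\sum_{n\le 0}c_n2^n\in\mathbb{Z}[1/2]$. Property $I$: $\alpha_\infty\in(-1,1]$ and $v_2(\alpha_{\langle 2\rangle})>0$. For $\alpha\in K^\times$ let $a^{(0)}(\alpha)=2m+\lfloor(1/\alpha)_{\langle 2\rangle}\rfloor_2$, where $m$ is the smallest among the integers $i$ minimizing $|(1/\alpha)_\infty-2i-\lfloor(1/\alpha)_{\langle 2\rangle}\rfloor_2|$;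 let $a^{(1)}(\alpha)=m'+\lfloor(1/\alpha)_{\langle 2\rangle}\rfloor_2$, where $m'$ is the smallest among the integers $i$ minimizing $|(1/\alpha)_\infty-i-\lfloor(1/\alpha)_{\langle 2\rangle}\rfloor_2|$. Put $T_{2,\epsilon}(\alpha)=\frac1\alpha-a^{(\epsilon)}(\alpha)$ for $\epsilon\in\{0,1\}$. Algorithm: $\alpha_{(1)}=\alpha$; for $n\ge1$ put $\epsilon=0$ if $n$ is even, $\epsilon=1$ if $n$ is odd, $a_n(\alpha)=a^{(\epsilon)}(\alpha_{(n)})$ and $\alpha_{(n+1)}=T_{2,\epsilon}(\alpha_{(n)})$ (for $\alpha\in K\setminus\mathbb{Q}$ the algorithm never terminates). Convergents: $p_0=0$, $q_0=1$, and for $n\ge1$ $$\begin{pmatrix} p_{n-1} & p_n \\ q_{n-1} & q_n \end{pmatrix}=\begin{pmatrix} 0 & 1 \\ 1 & a_1(\alpha) \end{pmatrix}\cdots\begin{pmatrix} 0 & 1 \\ 1 & a_n(\alpha) \end{pmatrix};$$ $p_n,q_n\in\mathbb{Z}[1/2]$ and $q_n\ne0$. For $n\ge1$ put $p'_n=2^{-\sum_{s=1}^n v_2(a_s(\alpha))}p_n$ and $q'_n=2^{-\sum_{s=1}^n v_2(a_s(\alpha))}q_n$; these are coprime integers with $p'_n/q'_n=p_n/q_n$. *)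

(* Defs.v *)
From HB Require Import structures.
From mathcomp Require Import all_boot all_order all_algebra all_field.
From mathcomp Require Import lra.
From mathcomp Require Import all_classical all_reals all_analysis.

Set Implicit Arguments.
Unset Strict Implicit.
Unset Printing Implicit Defensive.
Import Order.TTheory GRing.Theory Num.Theory.

(* The ring Z_2 of 2-adic integers, as the inverse limit of the Z/2^n: [x n] is
   the representative in [0, 2^n) of x modulo 2^n. *)
Record Z2 := MkZ2 {
  Z2_val :> nat -> nat;
  Z2_coh : forall n, Z2_val n = Z2_val n.+1 %% 2 ^ n }.

HB.instance Definition _ := gen_eqMixin Z2.
HB.instance Definition _ := gen_choiceMixin Z2.

Section Z2Ring.
Local Open Scope nat_scope.

Lemma Z2_eqP (x y : Z2) : (forall n, x n = y n) -> x = y.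
Proof.
case: x y => [x Hx] [y Hy] /= /funext exy; move: Hx; rewrite exy => Hx.
by congr MkZ2; exact: Prop_irrelevance.
Qed.

Lemma Z2_small (x : Z2) n : x n %% 2 ^ n = x n.
Proof. by rewrite [in LHS]Z2_coh modn_mod -Z2_coh. Qed.

Lemma Z2_cohD (x : Z2) n k : x n = x (n + k) %% 2 ^ n.
Proof.
elim: k => [|k IH]; first by rewrite addn0 Z2_small.
by rewrite IH addnS (Z2_coh x (n + k)) modn_dvdm // dvdn_exp2l ?leq_addr.
Qed.

Let modS m n : m %% 2 ^ n.+1 %% 2 ^ n = m %% 2 ^ n.
Proof. by rewrite modn_dvdm // dvdn_exp2l. Qed.

Fact Z2_nat_subproof m n : m %% 2 ^ n = m %% 2 ^ n.+1 %% 2 ^ n.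
Proof. by rewrite modS. Qed.
Definition Z2_nat m := MkZ2 (Z2_nat_subproof m).

Fact Z2_add_subproof (x y : Z2) n :
  (x n + y n) %% 2 ^ n = (x n.+1 + y n.+1) %% 2 ^ n.+1 %% 2 ^ n.
Proof. by rewrite modS (Z2_coh x) (Z2_coh y) modnDm. Qed.
Definition Z2_add x y := MkZ2 (Z2_add_subproof x y).

Fact Z2_mul_subproof (x y : Z2) n :
  (x n * y n) %% 2 ^ n = (x n.+1 * y n.+1) %% 2 ^ n.+1 %% 2 ^ n.
Proof. by rewrite modS (Z2_coh x) (Z2_coh y) modnMm. Qed.
Definition Z2_mul x y := MkZ2 (Z2_mul_subproof x y).

Fact Z2_opp_subproof (x : Z2) n :
  (2 ^ n).-1 * x n %% 2 ^ n = (2 ^ n.+1).-1 * x n.+1 %% 2 ^ n.+1 %% 2 ^ n.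
Proof.
rewrite modS (Z2_coh x) modnMmr; apply/eqP.
rewrite -(eqn_modDr (x n.+1)) -!mulSnr !prednK ?expn_gt0 //.
by rewrite expnS mulnAC modnMl modnMr.
Qed.
Definition Z2_opp x := MkZ2 (Z2_opp_subproof x).

Fact Z2_addA : associative Z2_add.
Proof. by move=> x y z; apply: Z2_eqP => n /=; rewrite modnDmr modnDml addnA. Qed.
Fact Z2_addC : commutative Z2_add.
Proof. by move=> x y; apply: Z2_eqP => n /=; rewrite addnC. Qed.
Fact Z2_add0 : left_id (Z2_nat 0) Z2_add.
Proof. by move=> x; apply: Z2_eqP => n /=; rewrite mod0n add0n Z2_small. Qed.
Fact Z2_addN : left_inverse (Z2_nat 0) Z2_opp Z2_add.
Proof.
move=> x; apply: Z2_eqP => n /=.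
by rewrite modnDml -mulSnr prednK ?expn_gt0 // modnMr mod0n.
Qed.
HB.instance Definition _ :=
  GRing.isZmodule.Build Z2 Z2_addA Z2_addC Z2_add0 Z2_addN.

Fact Z2_mulA : associative Z2_mul.
Proof. by move=> x y z; apply: Z2_eqP => n /=; rewrite modnMmr modnMml mulnA. Qed.
Fact Z2_mulC : commutative Z2_mul.
Proof. by move=> x y; apply: Z2_eqP => n /=; rewrite mulnC. Qed.
Fact Z2_mul1 : left_id (Z2_nat 1) Z2_mul.
Proof. by move=> x; apply: Z2_eqP => n /=; rewrite modnMml mul1n Z2_small. Qed.
Fact Z2_mulD : left_distributive Z2_mul Z2_add.
Proof.
by move=> x y z; apply: Z2_eqP => n /=; rewrite modnMml modnDm mulnDl.
Qed.
Fact Z2_one_neq0 : Z2_nat 1 != Z2_nat 0.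
Proof. by apply/eqP => /(congr1 (fun x : Z2 => x 1)). Qed.
HB.instance Definition _ := GRing.Zmodule_isComNzRing.Build Z2
  Z2_mulA Z2_mulC Z2_mul1 Z2_mulD Z2_one_neq0.

Definition Z2_unit : pred Z2 := fun x => x 1 != 0.

Lemma Z2_unit_odd (x : Z2) n : Z2_unit x -> 0 < n -> odd (x n).
Proof.
case: n => // n; rewrite /Z2_unit => + _.
by rewrite (Z2_cohD x 1 n) expn1 modn2 eqb0 negbK add1n.
Qed.

Definition Z2_inv_val (x : Z2) n := (egcdn (x n) (2 ^ n)).1 %% 2 ^ n.

Lemma Z2_inv_valP (x : Z2) n : Z2_unit x ->
  Z2_inv_val x n * x n = 1 %[mod 2 ^ n].
Proof.
case: n => [|n] Ux; first by rewrite !modn1.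
have Ox := Z2_unit_odd Ux (ltn0Sn n).
have x_gt0 : 0 < x n.+1 by apply: odd_gt0.
rewrite modnMml; case: (egcdnP (2 ^ n.+1) x_gt0) => u v /= -> _.
have /eqP -> : coprime (x n.+1) (2 ^ n.+1) by rewrite coprimeXr // coprimen2.
by rewrite modnMDl.
Qed.

Fact Z2_inv_subproof (x : Z2) : Z2_unit x ->
  forall n, Z2_inv_val x n = Z2_inv_val x n.+1 %% 2 ^ n.
Proof.
move=> Ux n; set a := Z2_inv_val x n; set b := Z2_inv_val x n.+1.
have Ha : a * x n = 1 %[mod 2 ^ n] by apply: Z2_inv_valP.
have Hb : b * x n = 1 %[mod 2 ^ n].
  rewrite [x n]Z2_coh modnMmr -modS.
  by rewrite (Z2_inv_valP n.+1 Ux) modS.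
have ab : a = b %[mod 2 ^ n].
  rewrite -[a in LHS]muln1 -modnMmr -Hb modnMmr mulnCA.
  by rewrite -modnMmr Ha modnMmr muln1.
by rewrite -ab /a modn_mod.
Qed.

Definition Z2_inv (x : Z2) : Z2 :=
  match @idP (Z2_unit x) with
  | ReflectT Ux => MkZ2 (Z2_inv_subproof Ux)
  | ReflectF _ => x
  end.

Fact Z2_mulV : {in Z2_unit, left_inverse (1 : Z2)%R Z2_inv *%R}.
Proof.
move=> x Ux; rewrite /Z2_inv; case: {-}_ / idP => [Ux'|/(_ Ux)] //.
by apply: Z2_eqP => n; exact: Z2_inv_valP.
Qed.
Fact Z2_unitP (x y : Z2) : (y * x = 1)%R -> Z2_unit x.
Proof.
move=> /(congr1 (fun x : Z2 => x 1)) /= yx; apply/eqP => x0.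
by move: yx; rewrite x0 muln0.
Qed.
Fact Z2_inv_out : {in [predC Z2_unit], Z2_inv =1 id}.
Proof. by move=> x /negP nUx; rewrite /Z2_inv; case: {-}_ / idP. Qed.
HB.instance Definition _ :=
  GRing.ComNzRing_hasMulInverse.Build Z2 Z2_mulV Z2_unitP Z2_inv_out.

Lemma Z2_natrE m : (m%:R)%R = Z2_nat m.
Proof.
elim: m => [//|m IH]; rewrite mulrSr IH; apply: Z2_eqP => n /=.
by rewrite modnDm addn1.
Qed.

Lemma Z2_mulXn (x : Z2) a n : (2 ^+ a * x)%R n = 2 ^ a * x n %% 2 ^ n.
Proof. by rewrite -natrX Z2_natrE /= modnMml. Qed.

Lemma Z2_mulXI a (x : Z2) : (2 ^+ a * x = 0 -> x = 0)%R.
Proof.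
move=> x0; apply: Z2_eqP => n /=; rewrite mod0n (Z2_cohD x n a).
have := congr1 (fun x : Z2 => x (n + a)) x0.
rewrite Z2_mulXn /= mod0n expnD mulnC -muln_modl => /eqP.
by rewrite muln_eq0 expn_eq0 /= orbF => /eqP.
Qed.

Lemma Z2_factor (x : Z2) : x <> 0%R ->
  exists a (u : Z2), (u \is a GRing.unit) /\ (x = 2 ^+ a * u)%R.
Proof.
move=> nx0; have [n xn0] : exists n, x n != 0.
  apply/not_existsP => x0; apply: nx0; apply: Z2_eqP => n /=.
  by rewrite mod0n; have /negP := x0 n; rewrite negbK => /eqP.
case: (ex_minnP (ex_intro (fun n => x n != 0) n xn0)) => -[|a] xa0 min_a.
  by rewrite -Z2_small modn1 in xa0.
have x_a : x a = 0 by apply/eqP; apply: contraT => /min_a; rewrite ltnn.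
have Hu k : x (k + a) %/ 2 ^ a = x (k.+1 + a) %/ 2 ^ a %% 2 ^ k.
  by rewrite modn_divl -expnD addSn -Z2_coh.
exists a, (MkZ2 Hu); split; last first.
  apply: Z2_eqP => k; rewrite Z2_mulXn /= (Z2_cohD x k a) mulnC divnK //.
  by rewrite /dvdn addnC -Z2_cohD x_a.
rewrite unfold_in /= /Z2_unit /= add1n.
have: 2 ^ a %| x a.+1 by rewrite /dvdn -Z2_coh x_a.
case/dvdnP => q xq; move: xa0; rewrite xq mulnK ?expn_gt0 //.
by rewrite muln_eq0 negb_or => /andP[].
Qed.

Fact Z2_integral (x y : Z2) : (x * y = 0 -> (x == 0) || (y == 0))%R.
Proof.
case: (eqVneq x 0%R) => //= /eqP /Z2_factor [a [u [Uu ->]]].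
case: (eqVneq y 0%R) => //= /eqP /Z2_factor [b [v [Uv ->]]].
rewrite mulrACA -exprD => /Z2_mulXI uv0.
have : (u * v)%R \is a GRing.unit by rewrite unitrM Uu Uv.
by rewrite uv0 unitr0.
Qed.
HB.instance Definition _ := GRing.ComUnitRing_isIntegral.Build Z2 Z2_integral.

End Z2Ring.

Local Open Scope ring_scope.
Local Open Scope classical_set_scope.

Notation Q2 := {fraction Z2}.
Local Notation tofrac := (@tofrac Z2).

(* v_2(u) is the n with u in 2^n * Z_2^*; the convention v2 0 = 0 is junk
   (mathematically v_2(0) = +oo). *)
Definition v2 (u : Q2) : int :=
  xget 0 [set n : int |
    exists2 z : Z2, z \is a GRing.unit & u = 2 ^ n * tofrac z].

Definition norm2 (R : numFieldType) (u : Q2) : R :=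
  if u == 0 then 0 else 2 ^ (- v2 u).

Lemma Z2_two_neq0 : (2 : Z2) != 0.
Proof. by apply/eqP => /(congr1 (fun x : Z2 => x 2%N)). Qed.

Lemma Q2_two_neq0 : (2 : Q2) != 0.
Proof. by rewrite -(rmorph_nat tofrac) tofrac_eq0 Z2_two_neq0. Qed.

Lemma Q2_pow_unit (n : nat) (z w : Z2) : z \is a GRing.unit ->
  w \is a GRing.unit -> 2 ^+ n * tofrac z = tofrac w -> n = 0%N.
Proof.
move=> Uz Uw; rewrite -(rmorph_nat tofrac) -rmorphXn -rmorphM => /eqP.
rewrite tofrac_eq => /eqP zw.
case: n zw => // n zw; have : (2 ^+ n.+1 * z) \is a GRing.unit by rewrite zw.
by rewrite unitrM unitrX_pos.
Qed.

Lemma Q2_fracP (u : Q2) :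
  exists a b : Z2, b != 0 /\ u = tofrac a / tofrac b.
Proof.
suff [a [b [b0 Dab]]] : exists a b : Z2, b != 0 /\ tofrac b * u = tofrac a.
  by exists a, b; split=> //; rewrite -Dab mulrAC divff ?mul1r // tofrac_eq0.
elim/quotW: u => x; exists (frac x).1, (frac x).2; split.
  exact: denom_ratioP.
unlock FracField.tofrac; rewrite -[LHS]FracField.pi_mul; apply/eqP.
rewrite FracField.equivf_def /FracField.mulf.
by rewrite !numden_Ratio ?mul1r ?mulr1 ?oner_eq0 ?denom_ratioP // mulrC.
Qed.

Lemma v2_eq (n : int) (z : Z2) : z \is a GRing.unit -> v2 (2 ^ n * tofrac z) = n.
Proof.
move=> Uz; rewrite /v2; case: xgetP => [m _ [w Uw] | /(_ n)]; last first.
  by case; exists z.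
have wlog_le (m1 m2 : int) (z1 z2 : Z2) : z1 \is a GRing.unit ->
    z2 \is a GRing.unit -> m1 <= m2 ->
    2 ^ m1 * tofrac z1 = 2 ^ m2 * tofrac z2 -> m1 = m2.
  move=> U1 U2 le12 /(congr1 ( *%R (2 ^ (- m1)))).
  rewrite !mulrA -!expfzDr ?Q2_two_neq0 // addNr mul1r addrC.
  have : 0 <= m2 - m1 by rewrite subr_ge0.
  case Dm: (m2 - m1) => [k|] // _ /esym /(Q2_pow_unit U2 U1) k0.
  by apply/esym/subr0_eq; rewrite Dm k0.
case: (leP n m) => [le e|/ltW le e]; last exact: (wlog_le _ _ _ _ Uw Uz le).
by apply/esym; exact: (wlog_le _ _ _ _ Uz Uw le).
Qed.

Lemma v2P (u : Q2) : u != 0 ->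
  exists2 z : Z2, z \is a GRing.unit & u = 2 ^ v2 u * tofrac z.
Proof.
move=> u0; suff [n [z Uz ->]] : exists n : int,
    exists2 z : Z2, z \is a GRing.unit & u = 2 ^ n * tofrac z.
  by exists z => //; rewrite v2_eq.
have [a [b [b0 Du]]] := Q2_fracP u.
have a0 : a <> 0 by move=> a0; move: u0; rewrite Du a0 tofrac0 mul0r eqxx.
have [i [x [Ux Da]]] := Z2_factor a0.
have [j [y [Uy Db]]] := Z2_factor (elimN eqP b0).
exists (i%:Z - j%:Z), (x * y^-1); first by rewrite unitrM Ux unitrV.
have y0 : tofrac y != 0.
  by rewrite tofrac_eq0; apply: contraTneq Uy => ->; rewrite unitr0.
have DyV : tofrac y^-1 = (tofrac y)^-1.
  by apply: (mulfI y0); rewrite divff // -rmorphM divrr.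
rewrite Du Da Db !tofracM !tofracXn !rmorph_nat DyV expfzDr ?Q2_two_neq0 //.
by rewrite -exprnN invfM mulrACA.
Qed.

(* u = sum_n c_n 2^n in Q_2, where c_n = 0 for n < v_2(u) *)
Definition is_digits (u : Q2) (c : int -> bool) : Prop :=
  (forall n, n < v2 u -> c n = false) /\
  forall eps : rat, 0 < eps -> exists N0 : nat, forall N : nat, (N0 <= N)%N ->
    norm2 rat (u - \sum_(k < N) (c (v2 u + k%:Z))%:R * 2 ^ (v2 u + k%:Z)) < eps.

Lemma is_digits_exists (u : Q2) : exists c, is_digits u c.
Proof.
have [->|u0] := eqVneq u 0.
  exists (fun=> false); split=> // eps eps0; exists 0%N => N _.
  by rewrite big1 ?subr0 /norm2 ?eqxx // => k _; rewrite mul0r.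
have [z Uz Du] := v2P u0; set v := v2 u in Du *.
pose bit k := odd (z k.+1 %/ 2 ^ k).
pose c (n : int) := (v <= n) && bit `|(n - v)%R|%N.
exists c; split=> [n|]; first by rewrite /c leNgt => ->.
move=> eps eps0; pose N0 := Num.bound (2 ^ (- v) / eps : rat).
exists N0 => N leN; rewrite -/v.
have -> : \sum_(k < N) (c (v + k%:Z))%:R * 2 ^ (v + k%:Z)
          = 2 ^ v * tofrac (z N)%:R :> Q2.
  have -> : z N = (\sum_(k < N) bit k * 2 ^ k)%N.
    elim: (N) => [|M IH]; first by rewrite big_ord0 -Z2_small modn1.
    rewrite big_ord_recr /= -IH [z M]Z2_coh /bit.
    rewrite [LHS](divn_eq _ (2 ^ M)) addnC; congr (_ + _ * _)%N.
    have : (z M.+1 %/ 2 ^ M < 2)%N.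
      by rewrite ltn_divLR ?expn_gt0 // -expnS -Z2_small ltn_mod expn_gt0.
    by case: (_ %/ _)%N => [|[]].
  rewrite natr_sum rmorph_sum /= mulr_sumr; apply: eq_bigr => k _.
  rewrite /c lerDl le0z_nat addrAC subrr add0r expfzDr ?Q2_two_neq0 //.
  rewrite natrM natrX.
  by rewrite tofracM tofracXn !rmorph_nat mulrCA.
rewrite Du -mulrBr -rmorphB /norm2 mulf_eq0 expfz_eq0 (negPf Q2_two_neq0) andbF.
rewrite tofrac_eq0 /=; case: eqP => // zN0.
have [a [w [Uw Dw]]] := Z2_factor zN0.
have leNa : (N <= a)%N.
  rewrite leqNgt; apply/negP => ltaN.
  have : (z - (z N)%:R) a.+1 = 0%N.
    rewrite (Z2_cohD _ _ (N - a.+1)) subnKC // -[(z - _)]/(Z2_add z (Z2_opp _)).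
    rewrite Z2_natrE /= Z2_small modnDmr -mulSn prednK ?expn_gt0 //.
    by rewrite modnMr mod0n.
  rewrite Dw Z2_mulXn => /eqP; rewrite -/(dvdn _ _) expnSr.
  rewrite dvdn_pmul2l ?expn_gt0 //.
  by rewrite dvdn2 (Z2_unit_odd Uw).
rewrite Dw tofracM tofracXn rmorph_nat mulrA -[2 ^+ a]/(2 ^ a%:Z).
rewrite -expfzDr ?Q2_two_neq0 // v2_eq // opprD expfzDr //.
rewrite -exprnN ltr_pdivrMr ?exprn_gt0 // mulrC -ltr_pdivrMr //.
apply: lt_le_trans (archi_boundP _) _; first by rewrite divr_ge0 ?exprz_ge0 ?ltW.
rewrite -natrX ler_nat (leq_trans leN) // (leq_trans leNa) //.
by rewrite ltnW // ltn_expl.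
Qed.

Definition digits (u : Q2) : int -> bool :=
  xget (fun=> false) [set c | is_digits u c].

(* sum of c_n 2^n over n = -j <= 0; the terms with j > |v_2(u)| vanish *)
Definition floor2 (u : Q2) : rat :=
  \sum_(j < `|v2 u|%N.+1) (digits u (- j%:Z))%:R * 2 ^- j.

Section LeastArgmin.
Variable R : realType.

Definition minimizes (f : int -> R) (i : int) : Prop := forall j, f i <= f j.

Definition least_argmin (f : int -> R) : int :=
  xget 0 [set i | minimizes f i /\ forall j, minimizes f j -> i <= j].

Lemma least_argminP (f : int -> R) (c : int) (x : R) : 0 < c ->
  (forall i, f i = `|x - (c * i)%:~R|) ->
  minimizes f (least_argmin f) /\
  forall j, minimizes f j -> least_argmin f <= j.
Proof.
move=> c0 fE; suff [m Pm] : exists m, minimizes f m /\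
    forall j, minimizes f j -> m <= j.
  by rewrite /least_argmin; case: xgetP => [//|/(_ m)].
have cR0 : 0 < c%:~R :> R by rewrite ltr0z.
pose y := x / c%:~R; have {}fE i : f i = c%:~R * `|y - i%:~R|.
  rewrite fE -[c%:~R in RHS]gtr0_norm // -normrM mulrBr mulrCA divff ?gt_eqF //.
  by rewrite mulr1 intrM.
have minE i : minimizes f i <-> forall j : int, `|y - i%:~R| <= `|y - j%:~R|.
  by split=> H j; have := H j; rewrite !fE ler_pM2l.
pose k := Num.floor y.
have ky : k%:~R <= y by exact: floor_le.
have yk : y < k%:~R + 1 by rewrite -intrD1; exact: floorD1_gt.
have dist0 : `|y - k%:~R| = y - k%:~R by rewrite ger0_norm // subr_ge0.
have dist1 : `|y - (k + 1)%:~R| = k%:~R + 1 - y.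
  by rewrite intrD1 distrC ger0_norm // subr_ge0 ltW.
have left_far (j : int) : j < k -> y - k%:~R < `|y - j%:~R|.
  move=> jk; have : j%:~R < k%:~R :> R by rewrite ltr_int.
  by move=> jkR; rewrite ger0_norm; lra.
have right_far (j : int) : k + 1 <= j -> k%:~R + 1 - y <= `|y - j%:~R|.
  move=> jk; have : k%:~R + 1 <= j%:~R :> R by rewrite -intrD1 ler_int.
  by move=> jkR; rewrite distrC ger0_norm; lra.
have cmp (j : int) : [\/ j < k, j = k | k + 1 <= j].
  case: (ltgtP j k) => jk; [exact: Or31 | | exact: Or32].
  by apply: Or33; rewrite lezD1.
case: (leP (y - k%:~R) (k%:~R + 1 - y)) => near.
  exists k; split=> [|j /minE /(_ k)].
    apply/minE => j; rewrite dist0; case: (cmp j) => [/left_far/ltW //|->|].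
      by rewrite dist0.
    by move=> /right_far; apply: le_trans.
  by rewrite dist0 leNgt => H; rewrite leNgt; apply: contra H; exact: left_far.
exists (k + 1); split=> [|j /minE /(_ (k + 1))].
  apply/minE => j; rewrite dist1; case: (cmp j) => [/left_far|->|/right_far //].
    by move=> /(lt_trans near)/ltW.
  by rewrite dist0 ltW.
rewrite dist1; case: (cmp j) => [/left_far H|->|//].
  by rewrite leNgt (lt_trans near H).
by rewrite dist0 leNgt near.
Qed.

End LeastArgmin.

Section Algorithm.
Variables (R : realType) (K : fieldExtType rat).
Variables (sigma_oo : {rmorphism K -> R}) (sigma_2 : {rmorphism K -> Q2}).

Definition property_I (alpha : K) : Prop :=
  -1 < sigma_oo alpha <= 1 /\ 0 < v2 (sigma_2 alpha).

Definition partial_quotient (eps : bool) (alpha : K) : rat :=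
  let l := floor2 (sigma_2 alpha^-1) in
  let c : int := if eps then 1 else 2 in
  let m := least_argmin
    (fun i => `|sigma_oo alpha^-1 - (c * i)%:~R - ratr l|) in
  (c * m)%:~R + l.

Definition T2 (eps : bool) (alpha : K) : K :=
  alpha^-1 - ratr (partial_quotient eps alpha).

(* indices start at 1; the value at 0 is not used *)
Fixpoint alpha_ (alpha : K) (n : nat) : K :=
  match n with
  | 0 | 1 => alpha
  | n'.+1 => T2 (odd n') (alpha_ alpha n')
  end.

Definition a_ (alpha : K) (n : nat) : rat :=
  partial_quotient (odd n) (alpha_ alpha n).

(* columns (p_(n-1), q_(n-1)) and (p_n, q_n) *)
Definition convergent_mx (alpha : K) (n : nat) : 'M[rat]_2 :=
  \prod_(1 <= s < n.+1) \matrix_(i < 2, j < 2)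
    nth 0 (nth [::] [:: [:: 0; 1]; [:: 1; a_ alpha s]] i) j.

Definition p_ (alpha : K) (n : nat) : rat := convergent_mx alpha n 0 1.
Definition q_ (alpha : K) (n : nat) : rat := convergent_mx alpha n 1 1.

Definition sum_v2 (alpha : K) (n : nat) : int :=
  \sum_(1 <= s < n.+1) v2 (ratr (a_ alpha s)).

Definition p'_ (alpha : K) (n : nat) : rat := 2 ^ (- sum_v2 alpha n) * p_ alpha n.
Definition q'_ (alpha : K) (n : nat) : rat := 2 ^ (- sum_v2 alpha n) * q_ alpha n.

End Algorithm.

(* Main.v *)
(* Write x_n for alpha_(n+1). At both places x_n stays small (|x_n| < 1 and
   |x_n|_2 <= 1, with |x_n x_(n+1)| < 1/2 and |x_n x_(n+1)|_2 <= 1/2), and x_n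
   is a root of A X^2 + B X + C where A, B, C in Z[1/2] and 2 A x_n + B is
   (-1)^n times a constant delta. Then C = - x_n (2 A x_n + B - A x_n) is the
   leading coefficient for x_(n+1), so the leading coefficients stay 2-adically
   integral and bounded over R, and so does B. Hence A and B are bounded
   integers, which leaves finitely many x_n: the sequence is eventually periodic.

   With P_n = prod_(i < n) x_i one has
   alpha - p_n / q_n = (-1)^n P_n P_(n+1) / w_n, where w_n = q_n P_n satisfies
   w_(n+1) = 1 - w_n x_n x_(n+1); so w_n is a 2-adic unit, and |w_n| is bounded
   away from 0 and infinity (by periodicity, |x_n x_(n+1)| is bounded away from
   1/2). Up to bounded factors the errors are thus |P_n|^2 and |P_n|_2^2, and
   |q'_n| is 1 / (|P_n| |P_n|_2). Choose gamma so that
   gamma ln |P_n| = (1 - gamma) ln |P_n|_2 over one period; the difference of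
   the two sides is then bounded for all n, which gives both estimates. *)

From HB Require Import structures.
Require Import Defs.
From mathcomp Require Import all_boot all_order all_algebra all_field.
From mathcomp Require Import ring lra zify.
From mathcomp Require Import all_classical all_reals all_analysis.
Import Order.TTheory GRing.Theory Num.Theory.

Set Implicit Arguments.
Unset Strict Implicit.
Unset Printing Implicit Defensive.
Local Open Scope ring_scope.

(** * 2-adic integers, valuations and the 2-adic floor *)

Local Notation Z2_frac := (@tofrac Z2).

Definition Q2_int : {pred Q2} := fun u => `[< exists z : Z2, u = Z2_frac z >].

Lemma Q2_intP (u : Q2) : reflect (exists z : Z2, u = Z2_frac z) (u \in Q2_int).
Proof. exact: asboolP. Qed.

Fact Q2_int_subring_closed : subring_closed Q2_int.
Proof.
split=> [|_ _ /Q2_intP[x ->] /Q2_intP[y ->]|_ _ /Q2_intP[x ->] /Q2_intP[y ->]].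
- by apply/Q2_intP; exists 1; rewrite tofrac1.
- by apply/Q2_intP; exists (x - y); rewrite tofracB.
- by apply/Q2_intP; exists (x * y); rewrite tofracM.
Qed.
HB.instance Definition _ :=
  GRing.isSubringClosed.Build Q2 Q2_int Q2_int_subring_closed.

Lemma v2_unit (z : Z2) : z \is a GRing.unit -> v2 (Z2_frac z) = 0.
Proof. by move=> Uz; rewrite -[X in v2 X]mul1r -(expr0z (2 : Q2)) v2_eq. Qed.

Lemma v2M (u v : Q2) : u != 0 -> v != 0 -> v2 (u * v) = v2 u + v2 v.
Proof.
move=> /v2P[x Ux Du] /v2P[y Uy Dv].
rewrite {1}Du {1}Dv mulrACA -expfzDr ?Q2_two_neq0 // -tofracM v2_eq //.
by rewrite unitrM Ux.
Qed.

Lemma v2_1 : v2 1 = 0.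
Proof. by rewrite -(tofrac1 Z2) v2_unit ?unitr1. Qed.

Lemma v2V (u : Q2) : u != 0 -> v2 u^-1 = - v2 u.
Proof.
move=> u0; have uV0 : u^-1 != 0 by rewrite invr_eq0.
by apply/eqP; rewrite -addr_eq0 -(v2M uV0 u0) mulVf // v2_1.
Qed.

Lemma v2_2X (n : int) : v2 (2 ^ n) = n.
Proof. by rewrite -[X in v2 X]mulr1 -(tofrac1 Z2) v2_eq ?unitr1. Qed.

Lemma Q2_int_v2 (u : Q2) : u != 0 -> (u \in Q2_int) = (0 <= v2 u).
Proof.
move=> u0; apply/Q2_intP/idP => [[z Du]|v0].
  have z0 : z <> 0 by move=> z0; rewrite Du z0 tofrac0 eqxx in u0.
  have [a [w [Uw Dz]]] := Z2_factor z0.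
  by rewrite Du Dz tofracM tofracXn rmorph_nat (v2_eq a%:Z).
have [z _ Du] := v2P u0; move: v0 Du; case: (v2 u) => // n _ ->.
by exists (2 ^+ n * z); rewrite tofracM tofracXn rmorph_nat.
Qed.

Lemma Q2_int_half_v2 (u : Q2) : u != 0 -> (u / 2 \in Q2_int) = (0 < v2 u).
Proof.
move=> u0; rewrite Q2_int_v2 ?mulf_neq0 ?invr_eq0 ?Q2_two_neq0 //.
rewrite v2M ?invr_eq0 ?Q2_two_neq0 // -exprN1 v2_2X; lia.
Qed.

(** Membership of u in 2 Z_2 is written [u / 2 \in Q2_int], which also covers u = 0. An element of 1
    + 2 Z_2 is odd, hence a unit; the valuations of a_n and w_n are found this way. *)
Lemma v2_1D2 (u : Q2) : u / 2 \in Q2_int -> 1 + u != 0 /\ v2 (1 + u) = 0.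
Proof.
move=> /Q2_intP[z Du].
have U : 1 + 2 * z \is a GRing.unit.
  rewrite unfold_in /= /Z2_unit -[2]/(1 + 1) mulrDl mul1r /=.
  by rewrite -[1 %N]/1%N /=; lia.
have -> : 1 + u = Z2_frac (1 + 2 * z).
  rewrite tofracD tofrac1 tofracM rmorph_nat -Du mulrCA divff ?Q2_two_neq0 //.
  by rewrite mulr1.
split; last exact: v2_unit.
by rewrite tofrac_eq0; apply: contraTneq U => ->; rewrite unitr0.
Qed.

(** The floor removes all digits at exponents at most 0, so only positive powers of 2 remain. The
    morphism [iota] serves to make [ratr] a ring morphism into [Q2]. *)
Lemma floor2_congr (iota : {rmorphism rat -> Q2}) (u : Q2) : v2 u <= 0 ->
  (u - ratr (floor2 u)) / 2 \in Q2_int.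
Proof.
move=> v0.
have [_] : is_digits u (digits u).
  have [c Dc] := is_digits_exists u.
  exact: (@xgetPex _ (fun=> false) [set c | is_digits u c]%classic (ex_intro _ c Dc)).
move=> /(_ 1 ltr01)[N0 HN].
pose w := `|v2 u|%N; have vw : v2 u = - w%:Z by rewrite /w; lia.
(* The first w + 1 digits have exponents -w to 0 and form the floor; the next N0 have positive
   exponents. The remainder has norm below 1, hence lies in 2 Z_2. *)
have := HN (w.+1 + N0)%N (leq_addl _ _); rewrite big_split_ord /=.
set s1 := \sum_(i < w.+1) _; set s2 := \sum_(i < N0) _ => small.
have s1E : s1 = ratr (floor2 u).
  rewrite -(fmorph_eq_rat iota) /floor2 rmorph_sum /= -/w.
  rewrite (reindex_inj rev_ord_inj) /=.
  apply: eq_bigr => j _; rewrite subSS vw.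
  have -> : (- w%:Z + j%:Z = - (w - j)%N%:Z)%R by have := ltn_ord j; lia.
  by rewrite rmorphM rmorph_nat /= fmorphV rmorphXn rmorph_nat -exprnN.
have s2E : s2 / 2 \in Q2_int.
  rewrite mulr_suml rpred_sum // => j _; rewrite vw.
  have -> : (- w%:Z + (w.+1 + j)%N%:Z = j%:Z + 1)%R by lia.
  rewrite expfzDr ?Q2_two_neq0 // expr1z -!mulrA divff ?Q2_two_neq0 // mulr1.
  by rewrite rpredM ?rpred_nat // rpredX ?rpred_nat.
have smallE : (u - (s1 + s2)) / 2 \in Q2_int.
  have [->|e0] := eqVneq (u - (s1 + s2)) 0; first by rewrite mul0r rpred0.
  rewrite Q2_int_half_v2 //; move: small; rewrite /norm2 (negPf e0) => small.
  rewrite ltNge; apply/negP => le0; move: small; apply/negP; rewrite -leNgt.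
  by rewrite -(expr0z (2 : rat)) ler_weXz2l ?oppr_ge0 //.
have -> : u - ratr (floor2 u) = (u - (s1 + s2)) + s2 by rewrite -s1E; ring.
by rewrite mulrDl rpredD.
Qed.

(** * The ring Z[1/2] *)

Definition dyadic : {pred rat} :=
  fun x => `[< exists n : nat, 2 ^+ n * x \is a Num.int >].

Lemma dyadicP (x : rat) :
  reflect (exists n : nat, 2 ^+ n * x \is a Num.int) (x \in dyadic).
Proof. exact: asboolP. Qed.

Fact dyadic_subring_closed : subring_closed dyadic.
Proof.
split=> [|x y /dyadicP[m mx] /dyadicP[n ny]|x y /dyadicP[m mx] /dyadicP[n ny]].
- by apply/dyadicP; exists 0%N; rewrite mulr1 rpred1.
- apply/dyadicP; exists (m + n)%N; rewrite mulrBr {1}addnC !exprD -!mulrA.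
  by rewrite rpredB // rpredM // rpredX // rpred_nat.
- by apply/dyadicP; exists (m + n)%N; rewrite exprD mulrACA rpredM.
Qed.
HB.instance Definition _ :=
  GRing.isSubringClosed.Build rat dyadic dyadic_subring_closed.

Lemma dyadic_floor2 (u : Q2) : floor2 u \in dyadic.
Proof.
apply: rpred_sum => j _; apply: rpredM; first exact: rpred_nat.
by apply/dyadicP; exists j; rewrite mulfV ?rpred1 // expf_neq0.
Qed.

Lemma Z2_half_int (m : int) (t : Z2) : m%:~R = 2 * t -> (2 %| m)%Z.
Proof.
wlog m0 : m t / 0 <= m => [H E|].
  case: (leP 0 m) => [m0|/ltW m0]; first exact: H E.
  suff : (2 %| - m)%Z by lia.
  by apply: (H _ (- t)); rewrite ?oppr_ge0 // mulrN -E mulrNz.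
case: m m0 => // n _ E; have : (n%:Z%:~R : Z2) 1%N = (2 ^+ 1 * t) 1%N.
  by rewrite E expr1.
have -> : n%:Z%:~R = Z2_nat n by rewrite -pmulrn Z2_natrE.
by rewrite Z2_mulXn /=; lia.
Qed.

Lemma dyadic_Q2_int (iota : {rmorphism rat -> Q2}) (x : rat) :
  x \in dyadic -> ratr x \in Q2_int -> x \is a Num.int.
Proof.
move=> /dyadicP[n]; rewrite -(fmorph_eq_rat iota) => + xZ.
elim: n => [|n IH]; first by rewrite expr0 mul1r.
move=> /intrP[m Dm]; apply: IH; have /Q2_intP[t Dt] : iota (2 ^+ n * x) \in Q2_int.
  by rewrite rmorphM rmorphXn rmorph_nat rpredM // rpredX // rpred_nat.
have /dvdzP[k Dk] : (2 %| m)%Z.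
  apply: (@Z2_half_int _ t); apply/eqP; rewrite -tofrac_eq; apply/eqP.
  rewrite tofracM !rmorph_nat -Dt rmorph_int -(rmorph_int iota) -Dm.
  by rewrite exprS -mulrA rmorphM rmorph_nat.
apply/intrP; exists k; apply: (@mulfI _ 2) => //.
by rewrite mulrA -exprS Dm Dk intrM mulrC.
Qed.

(** * Quadratic equations, pigeonhole and nearest multiples *)

Lemma dim2_quadratic (K : fieldExtType rat) (x : K) :
  \dim {:K} = 2%N -> x \notin 1%VS ->
  exists A B C : int, A != 0 /\ A%:~R * x ^+ 2 + B%:~R * x + C%:~R = 0.
Proof.
move=> dimK irr_x.
have fr : free [:: x; 1%R].
  by rewrite free_cons span_seq1 irr_x free_cons span_nil memv0 oner_eq0 nil_free.
have full : <<[:: x; 1%R]>>%VS = fullv.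
  by apply/eqP; rewrite eqEdim subvf dimK (eqP fr).
have : x ^+ 2 \in <<[:: x; 1%R]>>%VS by rewrite full memvf.
rewrite span_cons span_seq1 => /memv_addP[_ /vlineP[b ->] [_ /vlineP[c ->] E]].
exists (denq b * denq c), (- (numq b * denq c)), (- (denq b * numq c)).
split; first by rewrite mulf_neq0 ?denq_neq0.
have num (d : rat) : d%:A * (denq d)%:~R = (numq d)%:~R :> K.
  by rewrite -[d%:A]/(in_alg K d) -(rmorph_int (in_alg K)) -rmorphM -numqE rmorph_int.
rewrite E -[b *: x]mulr_algl !(intrM, mulrNz) -!num; ring.
Qed.

Lemma bounded_pigeonhole (f : nat -> int * int) (M : nat) :
  (forall n, `|(f n).1| <= M%:Z /\ `|(f n).2| <= M%:Z) ->
  exists i j, (i < j)%N /\ f i = f j.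
Proof.
(* Adding M moves [-M, M] onto [0, 2 M], which leaves finitely many codes. *)
move=> fM; pose N := M.*2.+1.
pose code n : 'I_N * 'I_N :=
  (inord (absz ((f n).1 + M%:Z)), inord (absz ((f n).2 + M%:Z))).
have codeI i j : code i = code j -> f i = f j.
  move=> [] /(congr1 val) /= + /(congr1 val) /=.
  have := fM i; have := fM j; case: (f i) (f j) => [a b] [c d] /= [? ?] [? ?].
  rewrite !inordK ?ltnS; try lia.
  by move=> ? ?; congr pair; lia.
pose g (i : 'I_(#|{: 'I_N * 'I_N}|.+1)) := code i.
have /injectivePn[i [j ij gij]] : ~~ injectiveb g.
  by apply/injectiveP => /leq_card; rewrite card_ord ltnn.
have {}ij : i != j :> nat by [].
have {}gij := codeI _ _ gij.
case: (ltngtP i j) ij => // ij _; first by exists i, j.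
by exists j, i.
Qed.

(** Comparison with the neighbours m - 1 and m + 1 suffices: beyond distance c / 2, one of them
    would be closer. *)
Lemma minimizes_half (R : realType) (c : int) (x : R) : 0 < c ->
  `|x - (c * least_argmin (fun i => `|x - (c * i)%:~R|))%:~R| <= c%:~R / 2.
Proof.
move=> c0; have [] := least_argminP c0 (fun i => erefl `|x - (c * i)%:~R|).
set m := least_argmin _ => min_m _.
have := min_m (m - 1); have := min_m (m + 1).
rewrite !intrM intrD intrB mulrDr mulrBr mulr1.
have : 0 < c%:~R :> R by rewrite ltr0z.
move: (c%:~R : R) (m%:~R : R) => C M C0.
case: (ger0P (x - C * M)); case: (ger0P (x - (C * M + C)));
  case: (ger0P (x - (C * M - C))); lra.
Qed.

(** * Size of the orbit at the real and the 2-adic place *)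

Section Orbit.
Variables (R : realType) (K : fieldExtType rat).
Variables (sigma_oo : {rmorphism K -> R}) (sigma_2 : {rmorphism K -> Q2}).

Let ratK (b : rat) : ratr b = b%:A :> K.
Proof. by rewrite alg_num_field. Qed.

Let iota : {rmorphism rat -> Q2} := sigma_2 \o in_alg K.

Lemma sigma_2_ratr b : sigma_2 (ratr b) = ratr b.
Proof. exact: fmorph_rat. Qed.

Lemma ratr_mem1 b : ratr b \in (1%VS : {vspace K}).
Proof. by rewrite ratK memvZ ?mem1v. Qed.

Lemma irrational_neq0 (x : K) : x \notin 1%VS -> x != 0.
Proof. by apply: contraNneq => ->; rewrite mem0v. Qed.

Lemma T2_irrational eps (x : K) :
  x \notin 1%VS -> T2 sigma_oo sigma_2 eps x \notin 1%VS.
Proof.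
apply: contra => Tx; rewrite -[x]invrK (@memvV _ _ 1%AS).
rewrite -[x^-1](subrK (ratr (partial_quotient sigma_oo sigma_2 eps x))).
by rewrite rpredD ?ratr_mem1.
Qed.

Lemma T2_real eps (x : K) :
  `|sigma_oo (T2 sigma_oo sigma_2 eps x)| <= if eps then 2^-1 else 1.
Proof.
rewrite /T2 /partial_quotient; set l := floor2 _; set c : int := if eps then 1 else 2.
rewrite rmorphB fmorph_rat rmorphD /= ratr_int [_%:~R + _]addrC opprD addrA.
set y := sigma_oo x^-1 - ratr l.
rewrite (_ : (fun i => _) = (fun i : int => `|y - (c * i)%:~R|)); last first.
  by apply/funext => i; rewrite addrAC.
have c0 : 0 < c by rewrite /c; case: (eps).
apply: le_trans (minimizes_half y c0) _.
by rewrite /c; case: (eps); lra.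
Qed.

(** Removing the floor from 1/x leaves an element of 2 Z_2; subtracting a further integer keeps it
    in Z_2, and subtracting an even one keeps it in 2 Z_2. *)
Lemma T2_2adic (x : K) : x != 0 -> sigma_2 x \in Q2_int ->
  sigma_2 (T2 sigma_oo sigma_2 true x) \in Q2_int /\
  sigma_2 (T2 sigma_oo sigma_2 false x) / 2 \in Q2_int.
Proof.
move=> x0; rewrite Q2_int_v2 ?fmorph_eq0 // => v0.
have /(floor2_congr iota) : v2 (sigma_2 x^-1) <= 0.
  by rewrite fmorphV v2V ?fmorph_eq0 // oppr_le0.
rewrite /T2 /partial_quotient; set l := floor2 _; set m1 := least_argmin _.
set m2 := least_argmin _.
set u := sigma_2 x^-1 - ratr l => uZ.
have TE (c : rat) : sigma_2 (x^-1 - ratr (c + l)) = 2 * (u / 2) - ratr c.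
  rewrite ratK rmorphB scalerDl rmorphD /= -!ratK !sigma_2_ratr.
  rewrite mulrCA divff ?Q2_two_neq0 // mulr1 /u; ring.
rewrite !TE !ratr_int; split.
  by rewrite rpredB ?rpred_int // rpredM ?rpred_nat.
rewrite intrM mulrBl mulrAC divff ?Q2_two_neq0 // mul1r rpredB //.
by rewrite mulrAC divff ?Q2_two_neq0 // mul1r rpred_int.
Qed.

Lemma dyadic_partial_quotient eps x :
  partial_quotient sigma_oo sigma_2 eps x \in dyadic.
Proof. by rewrite rpredD ?rpred_int ?dyadic_floor2. Qed.

Variable alpha : K.
Hypothesis alpha_irr : alpha \notin 1%VS.
Hypothesis alpha_I : property_I sigma_oo sigma_2 alpha.

Local Notation x_ n := (alpha_ sigma_oo sigma_2 alpha n.+1).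
Local Notation a_ n := (a_ sigma_oo sigma_2 alpha n).

Lemma alpha_irrational n : x_ n \notin 1%VS.
Proof. by elim: n => //= n; exact: T2_irrational. Qed.

Lemma alpha_neq0 n : x_ n != 0.
Proof. exact/irrational_neq0/alpha_irrational. Qed.

Lemma alpha_T2 n : x_ n.+1 = T2 sigma_oo sigma_2 (odd n.+1) (x_ n).
Proof. by []. Qed.

Lemma alpha_S n : x_ n.+1 = (x_ n)^-1 - ratr (a_ n.+1).
Proof. by []. Qed.

(** The gain alternates: terms of even index come from epsilon = 0 and gain a factor 2 at the 2-adic
    place, terms of odd index come from epsilon = 1 and gain at the real place. Property I lets x_0
    count as even. *)
Lemma alpha_2adic n : sigma_2 (x_ n) \in Q2_int /\
  (~~ odd n -> sigma_2 (x_ n) / 2 \in Q2_int).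
Proof.
elim: n => [|n [IH _]].
  case: alpha_I => _ v0; have s0 : sigma_2 alpha != 0.
    by rewrite fmorph_eq0 irrational_neq0.
  by rewrite Q2_int_half_v2 // Q2_int_v2 // v0 ltW.
have [T1 T0] := T2_2adic (alpha_neq0 n) IH.
rewrite alpha_T2 oddS; case: (odd n) => /=; last by split=> //; exact: T1.
split; last by move=> _; exact: T0.
rewrite -[sigma_2 _](divfK Q2_two_neq0).
by rewrite rpredM // (rpred_nat _ 2).
Qed.

Lemma alpha_real n : `|sigma_oo (x_ n)| < 1 /\
  (odd n -> `|sigma_oo (x_ n)| <= 2^-1).
Proof.
have le1 : `|sigma_oo (x_ n)| <= 1 /\ (odd n -> `|sigma_oo (x_ n)| <= 2^-1).
  case: n => [|n].
    by case: alpha_I => /andP[? ?] _; split=> //; rewrite ler_norml; lra.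
  have := T2_real (odd n.+1) (x_ n); rewrite -alpha_T2 oddS; case: (odd n) => //= h.
  by split=> //; lra.
(* Irrationality excludes the values 1 and -1, which makes the bound strict. *)
have rat1 (b : rat) : sigma_oo (x_ n) != ratr b.
  rewrite -(fmorph_rat sigma_oo) (inj_eq (fmorph_inj _)).
  by apply: contraNneq (alpha_irrational n) => ->; exact: ratr_mem1.
case: le1 => le1 half; split=> //; rewrite lt_neqAle le1 andbT.
rewrite eqr_norml ler01 andbT negb_or; have := rat1 1%:~R; have := rat1 (-1)%:~R.
by rewrite !ratr_int mulrN1z => -> ->.
Qed.

(** * Bounded quadratic equations and periodicity *)

Lemma alpha_quadratic (A0 B0 C0 : int) (delta := 2 * A0%:~R * alpha + B0%:~R) :
  A0%:~R * alpha ^+ 2 + B0%:~R * alpha + C0%:~R = 0 ->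
  exists M : nat, forall n, exists A B : int,
    [/\ `|A| <= M%:Z, `|B| <= M%:Z & 2 * A%:~R * x_ n + B%:~R = (-1) ^+ n * delta].
Proof.
move=> alpha_root; pose k := in_alg K : {rmorphism rat -> K}.
have sk b : sigma_2 (k b) = ratr b by rewrite -(fmorph_eq_rat iota).
have sR b : sigma_oo (k b) = ratr b.
  by rewrite -(fmorph_eq_rat (sigma_oo \o k : {rmorphism rat -> R})).
pose d := `|sigma_oo delta|; pose m : R := `|A0%:~R|.
have d0 : 0 <= d by exact: normr_ge0.
have m0 : 0 <= m by exact: normr_ge0.
have dZ : sigma_2 delta \in Q2_int.
  rewrite rmorphD !rmorphM !rmorph_int rmorph_nat.
  have [aZ _] := alpha_2adic 0.
  by rewrite rpredD ?rpredM ?rpred_int ?(rpred_nat _ 2).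
have norm_sign n : `|sigma_oo ((-1) ^+ n * delta)| = d.
  by rewrite rmorphM rmorph_sign normrMsign.
(* The bound on |A| alternates: a step from even n may add d, while a step from odd n, where |x_n|
   is at most 1/2, brings it back below d + m. *)
have inv n : exists A B C : rat, [/\ [/\ A \in dyadic, B \in dyadic & C \in dyadic],
    k A * x_ n ^+ 2 + k B * x_ n + k C = 0,
    2 * k A * x_ n + k B = (-1) ^+ n * delta,
    ratr A \in Q2_int &
    `|ratr A : R| <= d + m + (if odd n then d else 0)].
  elim: n => [|n [A [B [C [[Ad Bd Cd] root_n der_n AZ Am]]]]].
    exists A0%:~R, B0%:~R, C0%:~R; rewrite !rpred_int !ratr_int !rmorph_int.
    rewrite rpred_int addr0 mul1r; split=> //=.
    by rewrite -/m; lra.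
  set a := a_ n.+1; have ad : a \in dyadic by exact: dyadic_partial_quotient.
  have x0 := alpha_neq0 n; have xS : x_ n.+1 = (x_ n)^-1 - k a.
    by rewrite alpha_S ratK.
  have CE : k C = - x_ n * ((-1) ^+ n * delta - k A * x_ n).
    rewrite -der_n; apply/eqP; rewrite -subr_eq0 -[X in _ == X]root_n.
    by apply/eqP; ring.
  (* These come from substituting x_n = 1 / (x_(n+1) + a) and clearing denominators. *)
  exists C, (B + C * a *+ 2), (A + B * a + C * a ^+ 2); split.
  - by split; rewrite // !rpredD ?rpredMn ?rpredM ?rpredX.
  - rewrite xS -[RHS](mul0r (x_ n ^- 2)) -root_n; field; exact: x0.
  - rewrite xS exprS mulN1r mulNr -der_n.
    apply/eqP; rewrite -addr_eq0 -[X in _ == X](mulr0 (2 / x_ n)) -root_n.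
    by apply/eqP; field; exact: x0.
  - have [xZ _] := alpha_2adic n.
    rewrite -sk CE rmorphM rmorphN rmorphB !rmorphM rmorph_sign sk.
    apply: rpredM; first by rewrite rpredN.
    by apply: rpredB; apply: rpredM; rewrite ?rpred_sign.
  have [x1 xhalf] := alpha_real n.
  rewrite -sR CE mulNr rmorphN normrN rmorphM normrM.
  have : `|sigma_oo ((-1) ^+ n * delta - k A * x_ n)|
      <= d + `|ratr A| * `|sigma_oo (x_ n)|.
    by rewrite rmorphB (le_trans (ler_normB _ _)) // norm_sign rmorphM normrM sR.
  have A1 : 0 <= `|ratr A : R| by [].
  have := normr_ge0 (sigma_oo (x_ n)).
  move: x1 xhalf Am A1.
  move: `|ratr A| `|sigma_oo (x_ n)| `|sigma_oo (_ - _)| => z r y.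
  rewrite oddS; case: (odd n) => /= r1 rh zm z0 r0 yz; last first.
    have zr : z * r <= z by rewrite ler_piMr // ltW.
    have : r * y <= r * (d + z) by rewrite ler_wpM2l //; lra.
    have : r * (d + z) <= d + z by rewrite ler_piMl //; lra.
    by lra.
  have {}rh := rh isT; have zr : z * r <= z / 2 by rewrite ler_wpM2l.
  have : r * y <= r * (d + z / 2) by rewrite ler_wpM2l //; lra.
  have : r * (d + z / 2) <= 2^-1 * (d + z / 2) by rewrite ler_wpM2r //; lra.
  by lra.
(* Since |A| is at most 2 d + m and |x_n| < 1, |B| is at most d + 2 (2 d + m). *)
pose M := Num.bound (5 * (d + m)); exists M => n.
have [A [B [C [[Ad Bd Cd] _ der_n AZ Am]]]] := inv n.
have BE : k B = (-1) ^+ n * delta - 2 * k A * x_ n by rewrite -der_n; ring.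
have BZ : ratr B \in Q2_int.
  have [xZ _] := alpha_2adic n.
  rewrite -sk BE rmorphB !rmorphM rmorph_sign rmorph_nat sk.
  apply: rpredB; first by apply: rpredM; rewrite ?rpred_sign.
  by apply: rpredM => //; apply: rpredM; rewrite ?(rpred_nat _ 2).
have /archi_boundP bM : 0 <= 5 * (d + m) by lra.
have Am' : `|ratr A : R| <= 2 * d + m by move: Am; case: (odd n); lra.
have Bm : `|ratr B : R| <= 5 * (d + m).
  rewrite -sR BE rmorphB (le_trans (ler_normB _ _)) // norm_sign !rmorphM.
  rewrite !normrM rmorph_nat normr_nat sR.
  have [x1 _] := alpha_real n; have := normr_ge0 (sigma_oo (x_ n)).
  have : 0 <= `|ratr A : R| by [].
  by nra.
have := dyadic_Q2_int iota Ad AZ; have := dyadic_Q2_int iota Bd BZ.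
move=> /intrP[b Db] /intrP[a Da]; exists a, b; split.
- rewrite -(ler_int R) intr_norm -[a%:~R](ratr_int R) -Da /=.
  by apply/ltW/(le_lt_trans _ bM); lra.
- rewrite -(ler_int R) intr_norm -[b%:~R](ratr_int R) -Db /=.
  exact/ltW/(le_lt_trans _ bM).
- by rewrite -der_n Da Db !rmorph_int.
Qed.

Lemma alpha_periodic : \dim {:K} = 2%N ->
  exists m T, (0 < T)%N /\ forall n, (m <= n)%N -> x_ (n + T) = x_ n.
Proof.
move=> dimK; have [A0 [B0 [C0 [A00 root0]]]] := dim2_quadratic dimK alpha_irr.
have [M coefs] := alpha_quadratic root0; move: coefs; set delta := _ + _ => coefs.
(* Restricting to even indices fixes the sign of delta, and makes equal terms evolve with the same
   epsilon. *)
have /choice[f fP] : forall n, exists AB : int * int,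
    [/\ `|AB.1| <= M%:Z, `|AB.2| <= M%:Z & 2 * AB.1%:~R * x_ n.*2 + AB.2%:~R = delta].
  move=> n; have [A [B [? ? E]]] := coefs n.*2; exists (A, B); split=> //=.
  by rewrite E -muln2 exprM sqrr_sign mul1r.
have two0 : (2 : K) != 0 by rewrite -(rmorph_nat (in_alg K)) fmorph_eq0.
have int1 (z : int) : z%:~R \in (1%VS : {vspace K}).
  by rewrite -(ratr_int K) ratr_mem1.
have int0 (z : int) : (z%:~R == 0 :> K) = (z == 0).
  by rewrite -(rmorph_int (in_alg K)) fmorph_eq0 intr_eq0.
(* Irrationality of delta forces A to be nonzero at every even index, so that (A, B) determines x_n
   there. *)
have delta_irr : delta \notin 1%VS.
  apply: contra alpha_irr => d1.
  have -> : alpha = (delta - B0%:~R) / (2 * A0%:~R).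
    by rewrite /delta; field; rewrite int0 A00.
  have mem2 : 2 \in (1%VS : {vspace K}) by exact: (int1 2).
  by rewrite (@memvM _ _ 1%AS) ?(@memvV _ _ 1%AS) ?(@memvM _ _ 1%AS) ?rpredB.
have [|i [j [ij fij]]] := @bounded_pigeonhole f M.
  by move=> n; have [] := fP n.
have xij : x_ i.*2 = x_ j.*2.
  have [_ _ Ei] := fP i; have [_ _ Ej] := fP j; rewrite -fij in Ej.
  have A1 : (f i).1 != 0.
    by apply: contraNneq delta_irr => A1; rewrite -Ei A1 mulr0 mul0r add0r.
  apply: (@mulfI _ (2 * (f i).1%:~R)); first by rewrite mulf_neq0 ?int0.
  by apply: (addIr (f i).2%:~R); rewrite Ei Ej.
exists i.*2, (j.*2 - i.*2)%N; split; first by lia.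
move=> n le_in; rewrite -(subnKC le_in); elim: (n - i.*2)%N => [|l IH].
  by rewrite addn0 xij; congr (alpha_ _ _ _ _.+1); lia.
rewrite addnS addSn !alpha_T2 IH; congr T2; lia.
Qed.

(** * Products of consecutive terms and valuations of partial quotients *)

Lemma alpha_mul_2adic n : sigma_2 (x_ n * x_ n.+1) / 2 \in Q2_int.
Proof.
(* Exactly one of n and n + 1 is even, and that term supplies the factor 2. *)
have [Z0 H0] := alpha_2adic n; have [Z1 H1] := alpha_2adic n.+1.
rewrite rmorphM; case: (boolP (odd n)) => on.
  by rewrite -mulrA rpredM // H1 //= on.
by rewrite mulrAC rpredM // H0.
Qed.

Lemma alpha_mul_real n : `|sigma_oo (x_ n * x_ n.+1)| < 2^-1.
Proof.
have [l0 h0] := alpha_real n; have [l1 h1] := alpha_real n.+1.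
have p0 : 0 < `|sigma_oo (x_ n)| by rewrite normr_gt0 fmorph_eq0 alpha_neq0.
have p1 : 0 < `|sigma_oo (x_ n.+1)| by rewrite normr_gt0 fmorph_eq0 alpha_neq0.
rewrite rmorphM normrM; case: (boolP (odd n)) => on.
  apply: lt_le_trans (h0 on); by rewrite gtr_pMr.
by apply: lt_le_trans (h1 _); rewrite ?gtr_pMl.
Qed.

(** One has a_(n+1) = (1 - x_n x_(n+1)) / x_n, whose numerator is a 2-adic unit. *)
Lemma v2_partial_quotient n : v2 (ratr (a_ n.+1)) = - v2 (sigma_2 (x_ n)).
Proof.
have s0 i : sigma_2 (x_ i) != 0 by rewrite fmorph_eq0 alpha_neq0.
have : - sigma_2 (x_ n * x_ n.+1) / 2 \in Q2_int.
  by rewrite mulNr rpredN alpha_mul_2adic.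
move=> /v2_1D2[u0 v0].
have -> : ratr (a_ n.+1) = (sigma_2 (x_ n))^-1 * (1 - sigma_2 (x_ n * x_ n.+1)).
  rewrite rmorphM mulrBr mulr1 mulKf // -fmorphV -rmorphB alpha_S opprB.
  by rewrite addrC subrK sigma_2_ratr.
by rewrite v2M ?invr_eq0 ?s0 // v0 addr0 v2V ?s0.
Qed.

Lemma v2_prod_alpha n :
  v2 (sigma_2 (\prod_(i < n) x_ i)) = \sum_(i < n) v2 (sigma_2 (x_ i)).
Proof.
elim: n => [|n IH]; first by rewrite !big_ord0 rmorph1 v2_1.
rewrite !big_ord_recr /= rmorphM v2M ?IH // fmorph_eq0; last exact: alpha_neq0.
by apply/prodf_neq0 => i _; exact: alpha_neq0.
Qed.

Lemma sum_v2E n :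
  sum_v2 sigma_oo sigma_2 alpha n = - \sum_(i < n) v2 (sigma_2 (x_ i)).
Proof.
rewrite /sum_v2 big_add1 /= big_mkord -sumrN.
by apply: eq_bigr => i _; rewrite v2_partial_quotient.
Qed.

(** * Convergents and their exact error *)

Local Notation M_ n := (convergent_mx sigma_oo sigma_2 alpha n).
Local Notation p_ n := (p_ sigma_oo sigma_2 alpha n).
Local Notation q_ n := (q_ sigma_oo sigma_2 alpha n).

Lemma convergent_mx0 : [/\ M_ 0 0 0 = 1, M_ 0 0 1 = 0, M_ 0 1 0 = 0 & M_ 0 1 1 = 1].
Proof. by rewrite /convergent_mx big_geq // !mxE. Qed.

Lemma convergent_mxS n i :
  M_ n.+1 i 0 = M_ n i 1 /\ M_ n.+1 i 1 = M_ n i 0 + M_ n i 1 * a_ n.+1.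
Proof.
rewrite /convergent_mx big_nat_recr //=; set X := \prod_(_ <= _ < _) _.
have l1 : lift ord0 ord0 = 1 :> 'I_2 by exact: val_inj.
by split; rewrite mxE !big_ord_recl big_ord0 !mxE /= ?mulr0 ?mulr1 ?add0r ?addr0 l1.
Qed.

Lemma prod_alphaS n : \prod_(i < n.+1) x_ i = (\prod_(i < n) x_ i) * x_ n.
Proof. exact: big_ord_recr. Qed.

Lemma q_alpha_sub_p n :
  ratr (q_ n) * alpha - ratr (p_ n) = (-1) ^+ n * \prod_(i < n.+1) x_ i.
Proof.
pose k := in_alg K : {rmorphism rat -> K}; rewrite !ratK -![_%:A]/(k _).
(* The recurrence has order two, so both columns go through the induction; the step is P_n (1 -
   a_(n+1) x_n) = P_n x_n x_(n+1). *)
suff [] : k (M_ n 1 1) * alpha - k (M_ n 0 1) = (-1) ^+ n * \prod_(i < n.+1) x_ i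
  /\ k (M_ n 1 0) * alpha - k (M_ n 0 0) = - ((-1) ^+ n * \prod_(i < n) x_ i).
  by [].
elim: n => [|n [IH1 IH0]].
  have [-> -> -> ->] := convergent_mx0; rewrite big_ord1 big_ord0 !rmorph0 !rmorph1.
  by split; rewrite !(mul1r, mul0r, subr0, sub0r, expr0).
have [E00 E01] := convergent_mxS n 0; have [E10 E11] := convergent_mxS n 1.
rewrite E00 E01 E10 E11; split; last by rewrite IH1 exprS mulN1r mulNr opprK.
have -> : k (M_ n 1 0 + M_ n 1 1 * a_ n.+1) * alpha
      - k (M_ n 0 0 + M_ n 0 1 * a_ n.+1)
  = (k (M_ n 1 0) * alpha - k (M_ n 0 0))
    + k (a_ n.+1) * (k (M_ n 1 1) * alpha - k (M_ n 0 1)) by ring.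
rewrite IH0 IH1 (prod_alphaS n.+1) (prod_alphaS n) (alpha_S n) ratK.
by rewrite -[_%:A]/(k _) exprS; field; exact: alpha_neq0.
Qed.

(** This is w_n; it compares q_n with 1 / P_n. *)
Definition scaled_q n : K := ratr (q_ n) * \prod_(i < n) x_ i.

Lemma scaled_q0 : scaled_q 0 = 1.
Proof.
have [_ _ _ E] := convergent_mx0.
by rewrite /scaled_q /Defs.q_ E big_ord0 mulr1 (ratr_nat _ 1).
Qed.

(** The invariant (q_m + q_(m-1) x_m) P_m = 1, taken at m = n + 1, is this recurrence. *)
Lemma scaled_qS n : scaled_q n.+1 = 1 - scaled_q n * (x_ n * x_ n.+1).
Proof.
pose k := in_alg K : {rmorphism rat -> K}.
suff E m : (k (M_ m 1 1) + k (M_ m 1 0) * x_ m) * \prod_(i < m) x_ i = 1.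
  have := E n.+1; have [-> _] := convergent_mxS n 1; rewrite mulrDl => <-.
  rewrite /scaled_q !ratK -![_%:A]/(k _) prod_alphaS; ring.
elim: m => [|m IH].
  have [_ _ -> ->] := convergent_mx0; rewrite big_ord0 rmorph0 rmorph1; ring.
have [-> ->] := convergent_mxS m 1; rewrite -[RHS]IH prod_alphaS (alpha_S m).
rewrite ratK -[_%:A]/(k _); field; exact: alpha_neq0.
Qed.

Lemma scaled_q_2adic n : sigma_2 (scaled_q n) != 0 /\ v2 (sigma_2 (scaled_q n)) = 0.
Proof.
suff [] : [/\ sigma_2 (scaled_q n) \in Q2_int, sigma_2 (scaled_q n) != 0
  & v2 (sigma_2 (scaled_q n)) = 0] by [].
elim: n => [|n [IH _ _]]; first by rewrite scaled_q0 rmorph1 rpred1 oner_eq0 v2_1.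
have hZ : - sigma_2 (scaled_q n * (x_ n * x_ n.+1)) / 2 \in Q2_int.
  by rewrite mulNr rpredN rmorphM -mulrA rpredM ?alpha_mul_2adic.
have [u0 v0] := v2_1D2 hZ; rewrite scaled_qS rmorphB rmorph1; split=> //.
by rewrite Q2_int_v2 // v0.
Qed.

Lemma prod_alpha_neq0 n : \prod_(i < n) x_ i != 0.
Proof. by apply/prodf_neq0 => i _; exact: alpha_neq0. Qed.

Lemma scaled_q_neq0 n : scaled_q n != 0.
Proof. by have [] := scaled_q_2adic n; rewrite fmorph_eq0. Qed.

Lemma convergent_error n : alpha - ratr (p_ n / q_ n) =
  (-1) ^+ n * (\prod_(i < n) x_ i * \prod_(i < n.+1) x_ i / scaled_q n).
Proof.
pose k := in_alg K : {rmorphism rat -> K}.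
have P0 := prod_alpha_neq0 n.
(* That q_n is nonzero is read off from w_n, a 2-adic unit. *)
have q0 : ratr (q_ n) != 0 :> K.
  by apply: contraNneq (scaled_q_neq0 n) => q0; rewrite /scaled_q q0 mul0r.
have -> : ratr (p_ n / q_ n) = ratr (p_ n) / ratr (q_ n) :> K.
  by rewrite !ratK -![_%:A]/(k _) fmorph_div.
have -> : alpha - ratr (p_ n) / ratr (q_ n)
    = (ratr (q_ n) * alpha - ratr (p_ n)) / ratr (q_ n) by field.
rewrite q_alpha_sub_p /scaled_q; field.
by rewrite P0 q0.
Qed.

(** * Errors at both places and the size of q'_n *)

Local Notation p'_ n := (p'_ sigma_oo sigma_2 alpha n).
Local Notation q'_ n := (q'_ sigma_oo sigma_2 alpha n).

Lemma p'_div_q' n : p'_ n / q'_ n = p_ n / q_ n.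
Proof. by rewrite /Defs.p'_ /Defs.q'_ -mulf_div divff ?mul1r // expfz_neq0. Qed.

Lemma convergent_error_real n : `|sigma_oo alpha - ratr (p'_ n / q'_ n)| =
  (\prod_(i < n) `|sigma_oo (x_ i)|) * (\prod_(i < n.+1) `|sigma_oo (x_ i)|)
    / `|sigma_oo (scaled_q n)|.
Proof.
rewrite p'_div_q' -(fmorph_rat sigma_oo) -rmorphB convergent_error.
rewrite rmorphM rmorph_sign normrMsign fmorph_div normf_div rmorphM normrM.
by rewrite !rmorph_prod !normr_prod.
Qed.

Lemma convergent_error_2adic n : norm2 R (sigma_2 alpha - ratr (p'_ n / q'_ n)) =
  2 ^ (- (\sum_(i < n) v2 (sigma_2 (x_ i)) + \sum_(i < n.+1) v2 (sigma_2 (x_ i)))).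
Proof.
have e0 : sigma_2 (alpha - ratr (p_ n / q_ n)) != 0.
  rewrite fmorph_eq0 subr_eq0.
  by apply: contraNneq alpha_irr => ->; exact: ratr_mem1.
rewrite p'_div_q' -sigma_2_ratr -rmorphB /norm2 (negPf e0).
have [s0 vs] := scaled_q_2adic n.
have v2s : v2 ((-1) ^+ n : Q2) = 0.
  by rewrite -(rmorph_sign (@tofrac Z2)) v2_unit // unitrX // unitrN unitr1.
congr (2 ^ (- _)); rewrite convergent_error rmorphM rmorph_sign fmorph_div rmorphM.
have P0 m : sigma_2 (\prod_(i < m) x_ i) != 0 by rewrite fmorph_eq0 prod_alpha_neq0.
have sV : (sigma_2 (scaled_q n))^-1 != 0 by rewrite invr_eq0.
rewrite !v2M ?mulf_neq0 ?signr_eq0 ?P0 //.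
by rewrite v2V // vs v2s oppr0 addr0 add0r !v2_prod_alpha.
Qed.

(** Here q_n = w_n / P_n, and the normalising power of 2 is 1 / |P_n|_2 because v_2(a_(i+1)) = -
    v_2(x_i). *)
Lemma norm_q' n : `|ratr (q'_ n) : R| =
  2 ^ (\sum_(i < n) v2 (sigma_2 (x_ i))) * `|sigma_oo (scaled_q n)|
    / \prod_(i < n) `|sigma_oo (x_ i)|.
Proof.
have P0 : \prod_(i < n) `|sigma_oo (x_ i)| != 0.
  by apply/prodf_neq0 => i _; rewrite normr_eq0 fmorph_eq0 alpha_neq0.
have -> : sigma_oo (scaled_q n) = ratr (q_ n) * \prod_(i < n) sigma_oo (x_ i).
  by rewrite /scaled_q rmorphM fmorph_rat rmorph_prod.
rewrite (normrM (ratr (q_ n))) normr_prod mulrA mulfK //.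
have -> : ratr (q'_ n) = 2 ^ (\sum_(i < n) v2 (sigma_2 (x_ i))) * ratr (q_ n) :> R.
  by rewrite /Defs.q'_ sum_v2E opprK rmorphM /= fmorphXz rmorph_nat.
by rewrite (normrM (2 ^ _)) ger0_norm // exprz_ge0.
Qed.

End Orbit.

(** * Bounds for periodic sums and perturbed recurrences *)

Lemma eventually_periodic_bounded (R : realDomainType) (s : nat -> R) (m T : nat) :
  (0 < T)%N -> (forall n, (m <= n)%N -> s (n + T)%N = s n) ->
  exists c, forall n, `|s n| <= c.
Proof.
move=> T0 sT; exists (\sum_(i < m + T) `|s i|) => n.
elim/ltn_ind: n => n IH; case: (ltnP n (m + T)) => [lt|ge].
  by rewrite (bigD1 (Ordinal lt)) //= lerDl sumr_ge0.
have -> : n = (n - T + T)%N by lia.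
by rewrite sT ?IH //; lia.
Qed.

(** A full period contributes zero, so the partial sums are themselves eventually periodic. *)
Lemma periodic_sums_bounded (R : realDomainType) (g : nat -> R) (m T : nat) :
  (0 < T)%N -> (forall n, (m <= n)%N -> g (n + T)%N = g n) ->
  \sum_(i < T) g (m + i)%N = 0 ->
  exists c, forall n, `|\sum_(i < n) g i| <= c.
Proof.
move=> T0 gT g0; pose s n := \sum_(i < n) g i.
apply: (@eventually_periodic_bounded _ s m T) => //.
move=> n le_mn; rewrite -(subnKC le_mn); elim: (n - m)%N => [|l IH].
  by rewrite addn0 /s big_split_ord /= g0 addr0.
by rewrite addnS addSn /s !big_ord_recr /= -/(s _) IH gT ?leq_addr.
Qed.

(** With U < 0 < V the sums over one period, gamma = V / (V - U) solves gamma U + (1 - gamma) V = 0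
    and lies strictly between 0 and 1. *)
Lemma balanced_sums_bounded (R : realFieldType) (u v : nat -> R) (m T : nat) :
  (0 < T)%N ->
  (forall n, (m <= n)%N -> u (n + T)%N = u n) ->
  (forall n, (m <= n)%N -> v (n + T)%N = v n) ->
  (forall n, u n < 0) -> (forall n, 0 <= v n) -> 0 < v m ->
  exists gamma c, 0 < gamma < 1 /\
    forall n, `|gamma * (\sum_(i < n) u i) + (1 - gamma) * (\sum_(i < n) v i)| <= c.
Proof.
case: T => // T _ uT vT u0 v0 vm.
pose U := \sum_(i < T.+1) u (m + i)%N; pose V := \sum_(i < T.+1) v (m + i)%N.
have U0 : U < 0.
  rewrite /U big_ord_recl ltr_wnDr // sumr_le0 // => i _; exact: ltW.
have V0 : 0 < V by rewrite /V big_ord_recl /= addn0 ltr_wpDr // sumr_ge0.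
have UV : 0 < V - U by lra.
pose gamma := V / (V - U).
pose g n := gamma * u n + (1 - gamma) * v n.
have gT n : (m <= n)%N -> g (n + T.+1)%N = g n by move=> le_mn; rewrite /g uT ?vT.
have g0 : \sum_(i < T.+1) g (m + i)%N = 0.
  by rewrite big_split /= -!mulr_sumr -/U -/V /gamma; field; lra.
have [c cP] := periodic_sums_bounded (ltn0Sn T) gT g0.
exists gamma, c; split.
  by rewrite /gamma divr_gt0 //= ltr_pdivrMr //; lra.
by move=> n; rewrite !mulr_sumr -big_split.
Qed.

(** The upper bound M = 1 / (1 - rho) is the fixed point of M = 1 + rho M. The lower bound 1 - rho M
    = (1 - 2 rho) / (1 - rho) is positive exactly because rho < 1/2. *)
Lemma ln_perturbed_unit_bounded (R : realType) (w t : nat -> R) (rho : R) :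
  rho < 2^-1 -> (forall n, `|t n| <= rho) ->
  w 0%N = 1 -> (forall n, w n.+1 = 1 - w n * t n) ->
  exists c, forall n, `|ln `|w n| | <= c.
Proof.
move=> rho2 tr w0 wS; have rho0 : 0 <= rho by apply: le_trans (tr 0%N).
have r1 : 0 < 1 - rho by lra.
pose M := (1 - rho)^-1; have M1 : M = 1 + rho * M by rewrite /M; field; lra.
have M0 : 0 < M by rewrite invr_gt0.
have wt n : `|w n| <= M -> `|w n * t n| <= rho * M.
  by move=> wM; rewrite normrM mulrC ler_pM.
have rM : rho * M < 1 by rewrite ltr_pdivrMr //; lra.
have bounds n : 1 - rho * M <= `|w n| <= M.
  elim: n => [|n /andP[_ /wt wn]].
    by rewrite w0 normr1; have := mulr_ge0 rho0 (ltW M0); lra.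
  have := ler_normB 1 (w n * t n); have := lerB_dist 1 (w n * t n).
  by rewrite wS normr1; lra.
exists (`|ln (1 - rho * M)| + `|ln M|) => n; have /andP[lo hi] := bounds n.
have lo0 : 0 < 1 - rho * M by lra.
have w_gt0 : 0 < `|w n| by apply: lt_le_trans lo.
have := ler_ln lo0 w_gt0; have := ler_ln w_gt0 M0; rewrite lo hi.
have := ler_norm (ln M); have := ler_norm (- ln (1 - rho * M)).
rewrite normrN => ? ? ? ?; rewrite ler_norml.
have := normr_ge0 (ln M); have := normr_ge0 (ln (1 - rho * M)); lra.
Qed.

(* P and P1 stand for |P_n| and |P_(n+1)|, V and V1 for the inverses of |P_n|_2
   and |P_(n+1)|_2, w for |w_n|, and q for |q'_n|. *)
Lemma convergent_estimates (R : realType) (P P1 w V V1 gamma c c' : R) :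
  0 < P1 <= P -> 0 < w -> 0 < V <= V1 -> 0 < gamma < 1 ->
  `|gamma * ln P + (1 - gamma) * ln V| <= c -> `|ln w| <= c' ->
  let q := V * w / P in
  P * P1 / w <= expR (2 * c + 2 * c') / q `^ (2 - 2 * gamma) /\
  (V * V1)^-1 <= expR (2 * c + 2 * c') / q `^ (2 * gamma).
Proof.
move=> /andP[P10 PP] w0 /andP[V0 VV] /andP[g0 g1] hc hw q.
have P0 : 0 < P by exact: lt_le_trans PP.
have q0 : 0 < q by rewrite divr_gt0 // mulr_gt0.
have lnq : ln q = ln V + ln w - ln P.
  by rewrite ln_div ?posrE ?mulr_gt0 // lnM.
have powE e : q `^ e = expR (e * ln q) by rewrite /powR gt_eqF.
move: hc hw; rewrite !ler_norml => /andP[c1 c2] /andP[w1 w2].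
split.
  apply: (@le_trans _ _ (P * P / w)).
    by rewrite ler_pM2r ?invr_gt0 // ler_pM2l.
  (* In logarithms, the terms in P and V collect to 2 (gamma ln P + (1 - gamma) ln V), at most 2 c,
     and (1 - 2 gamma) ln w is left over, at most c'. *)
  rewrite powE -expRN -expRD -ler_ln ?posrE ?expR_gt0 ?divr_gt0 ?mulr_gt0 //.
  rewrite expRK ln_div ?posrE ?mulr_gt0 // lnM // lnq; nra.
apply: (@le_trans _ _ (V * V)^-1).
  by rewrite lef_pV2 ?posrE ?mulr_gt0 ?ler_pM2l //; exact: lt_le_trans VV.
(* Now the same combination appears with the opposite sign, and 2 gamma ln w is left over; this
   accounts for 2 c'. *)
rewrite powE -expRN -expRD -ler_ln ?posrE ?expR_gt0 ?invr_gt0 ?mulr_gt0 //.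
rewrite expRK lnV ?posrE ?mulr_gt0 // lnM // lnq; nra.
Qed.

Lemma ln_prod (R : realType) (f : nat -> R) n : (forall i, 0 < f i) ->
  ln (\prod_(i < n) f i) = \sum_(i < n) ln (f i).
Proof.
move=> f0; elim: n => [|n IH]; first by rewrite !big_ord0 ln1.
by rewrite !big_ord_recr /= lnM ?IH // posrE // prodr_gt0.
Qed.

Lemma expz_sum (F : fieldType) (x : F) (k : nat -> int) n : x != 0 ->
  x ^ (\sum_(i < n) k i) = \prod_(i < n) x ^ k i.
Proof.
move=> x0; elim: n => [|n IH]; first by rewrite !big_ord0.
by rewrite !big_ord_recr /= expfzDr // IH.
Qed.

(** * Combination of the two places *)

Theorem theorem3p24 (R : realType) (K : fieldExtType rat)
    (sigma_oo : {rmorphism K -> R}) (sigma_2 : {rmorphism K -> Q2})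
    (K_quadratic : \dim {:K} = 2%N) (alpha : K)
    (alpha_irrational : alpha \notin 1%VS)
    (alpha_I : property_I sigma_oo sigma_2 alpha) :
  let p' := p'_ sigma_oo sigma_2 alpha in
  let q' := q'_ sigma_oo sigma_2 alpha in
  exists gamma C C' : R,
    [/\ 0 < gamma < 1, 0 < C, 0 < C' &
      forall n : nat, (0 < n)%N ->
        `|sigma_oo alpha - ratr (p' n / q' n)|
            <= C / `|ratr (q' n)| `^ (2 - 2 * gamma) /\
        norm2 R (sigma_2 alpha - ratr (p' n / q' n))
            <= C' / `|ratr (q' n)| `^ (2 * gamma)].
Proof.
move=> p' q'.
have x0 n : alpha_ sigma_oo sigma_2 alpha n.+1 != 0 by exact: alpha_neq0.
have [m [T [T_gt0 per]]] := alpha_periodic alpha_irrational alpha_I K_quadratic.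
pose x n := alpha_ sigma_oo sigma_2 alpha n.+1.
pose r n : R := `|sigma_oo (x n)|; pose k n := v2 (sigma_2 (x n)).
have r0 n : 0 < r n by rewrite normr_gt0 fmorph_eq0 x0.
have r1 n : r n < 1 by have [] := alpha_real alpha_irrational alpha_I n.
have s0 n : sigma_2 (x n) != 0 by rewrite fmorph_eq0 x0.
have k0 n : 0 <= k n.
  by have [] := alpha_2adic alpha_irrational alpha_I n; rewrite Q2_int_v2 ?s0.
have k_even n : 0 < k n.*2.
  have [_] := alpha_2adic alpha_irrational alpha_I n.*2.
  by rewrite odd_double Q2_int_half_v2 ?s0 //; apply.
have e1 n : 1 <= 2 ^ k n :> R by rewrite -(expr0z (2 : R)) ler_weXz2l ?ler1n ?k0.
have [gamma [c [gamma01 hc]]] : exists gamma c : R, 0 < gamma < 1 /\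
    forall n, `|gamma * (\sum_(i < n) ln (r i))
                + (1 - gamma) * (\sum_(i < n) ln (2 ^ k i))| <= c.
  (* The period is taken to start at 2 m, an even index, since the valuation is known to be positive
     only at even indices. *)
  apply: (@balanced_sums_bounded R (fun i => ln (r i)) (fun i => ln (2 ^ k i))
    m.*2 T) => //.
  - by move=> n le_mn; rewrite /r /x per //; lia.
  - by move=> n le_mn; rewrite /k /x per //; lia.
  - by move=> n; rewrite ln_lt0 // r0 r1.
  - by move=> n; rewrite ln_ge0.
  - by rewrite ln_gt0 // -(expr0z (2 : R)) ltr_eXz2l ?k_even // ltr1n.
(* Periodicity bounds the inverse of the gap, so |x_n x_(n+1)| stays below 1/2 by at least 1 / b,
   uniformly in n. *)
have [b hb] : exists b : R, forall n, `|(2^-1 - r n * r n.+1)^-1| <= b.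
  apply: (@eventually_periodic_bounded _ _ m T) => // n le_mn.
  by rewrite /r /x -addSn !per // leqW.
have r2 n : r n * r n.+1 < 2^-1.
  by rewrite -normrM -rmorphM; exact: alpha_mul_real.
have b0 : 0 < b.
  by apply: lt_le_trans (hb 0%N); rewrite normr_gt0 invr_eq0 subr_eq0 gt_eqF.
have rho_bound n : `|sigma_oo (x n * x n.+1)| <= 2^-1 - b^-1.
  rewrite rmorphM normrM -/(r n) -/(r n.+1) lerBrDr -lerBrDl.
  rewrite invf_ple ?posrE ?subr_gt0 //; apply: le_trans (hb n).
  by rewrite ler_norm.
pose w n : R := sigma_oo (scaled_q sigma_oo sigma_2 alpha n).
have [c' hc'] : exists c' : R, forall n, `|ln `|w n| | <= c'.
  apply: (@ln_perturbed_unit_bounded _ w (fun n => sigma_oo (x n * x n.+1))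
    (2^-1 - b^-1)) => //.
  - by rewrite gtrDl oppr_lt0 invr_gt0.
  - by rewrite /w scaled_q0 rmorph1.
  - by move=> n; rewrite /w -rmorphM scaled_qS // rmorphB rmorph1.
exists gamma, (expR (2 * c + 2 * c')), (expR (2 * c + 2 * c')).
split; rewrite ?expR_gt0 // => n _.
pose P n : R := \prod_(i < n) r i; pose V n : R := \prod_(i < n) 2 ^ k i.
have P0 i : 0 < P i by apply: prodr_gt0.
have e0 i : 0 < 2 ^ k i :> R by rewrite exprz_gt0.
have V0 i : 0 < V i by apply: prodr_gt0.
have PS : 0 < P n.+1 <= P n by rewrite P0 /P big_ord_recr /= ler_piMr ?ltW ?P0.
have VS : 0 < V n <= V n.+1 by rewrite V0 /V big_ord_recr /= ler_peMr ?e1 // ltW ?V0.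
have w0 : 0 < `|w n| by rewrite normr_gt0 fmorph_eq0 scaled_q_neq0.
have balance : `|gamma * ln (P n) + (1 - gamma) * ln (V n)| <= c.
  rewrite /P /V (@ln_prod _ r) // (@ln_prod _ (fun i => 2 ^ k i)) //; exact: hc.
have := convergent_estimates PS w0 VS gamma01 balance (hc' n).
have two0 : (2 : R) != 0 by [].
(* The powers of 2 become the products V, so that the 2-adic error reads 1 / (V_n V_(n+1)). *)
rewrite convergent_error_real // convergent_error_2adic // norm_q' //.
rewrite -invr_expz expfzDr // !(@expz_sum _ _ k) //.
Qed.
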